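(* For $t\in\mathbb{R}$ let $\{t\}=t-\lfloor t\rfloor$, where $\lfloor t\rfloor$ denotes the greatest integer less than or equal to $t$. Then the sequence whose $k$-th term ($k=0,1,2,\ldots$) is $$\frac{\ln(k+2)+\displaystyle\int_{k+2}^{\infty}\frac{\{t\}}{t^2}\,dt}{k!}$$ is a multiplier sequence.
   Context: A sequence of real numbers $\{\gamma_k\}_{k=0}^\infty$ is a multiplier sequence if the linear operator $T$ on real polynomials defined by $T[x^k]=\gamma_kx^k$, $k=0,1,2,\ldots$, has the property that $T[p]$ has no non-real zeros whenever the real polynomial $p$ has no non-real zeros (the zero polynomial is regarded as having no non-real zeros). *)

(* Defs.v *)
From HB Require Import structures.
From mathcomp Require Import all_boot all_order all_algebra.
From mathcomp Require Import all_classical all_reals all_analysis.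
From mathcomp Require Import complex.

Set Implicit Arguments.
Unset Strict Implicit.
Unset Printing Implicit Defensive.

Import Order.TTheory GRing.Theory Num.Theory.

Local Open Scope ring_scope.

(* The operator of a sequence g; the lemmas diag_op_linear and diag_opXn say
   that it is the linear operator determined by 'X^k |-> g k *: 'X^k. *)
Definition diag_op (R : realType) (g : nat -> R) (p : {poly R}) : {poly R} :=
  \poly_(k < size p) (g k * p`_k).

Lemma coef_diag_op (R : realType) (g : nat -> R) (p : {poly R}) (k : nat) :
  (diag_op g p)`_k = g k * p`_k.
Proof.
rewrite /diag_op coef_poly; case: ltnP => // le_pk.
by rewrite nth_default // mulr0.
Qed.

Lemma diag_op_linear (R : realType) (g : nat -> R) : linear (diag_op g).
Proof.
move=> a p q; apply/polyP => k.
by rewrite coefD coefZ !coef_diag_op coefD coefZ mulrDr mulrCA.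
Qed.

HB.instance Definition _ (R : realType) (g : nat -> R) :=
  GRing.isLinear.Build R {poly R} {poly R} _ (diag_op g) (diag_op_linear g).

Lemma diag_opXn (R : realType) (g : nat -> R) (k : nat) :
  diag_op g 'X^k = g k *: 'X^k.
Proof.
apply/polyP => j; rewrite coef_diag_op coefZ coefXn.
by case: eqP => [->|] //; rewrite !mulr0.
Qed.

(* The zero polynomial, of which every complex number is a root, is singled out
   because it counts as having no non-real zeros. *)
Definition no_nonreal_zeros (R : realType) (p : {poly R}) : Prop :=
  p = 0 \/
  forall z : R[i], root (map_poly (real_complex R) p) z -> complex.Im z = 0.

Definition multiplier_sequence (R : realType) (g : nat -> R) : Prop :=
  forall p : {poly R}, no_nonreal_zeros p -> no_nonreal_zeros (diag_op g p).

Definition frac_part (R : realType) (t : R) : R := t - (Num.floor t)%:~R.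

(* Main.v *)
Require Import Defs.
From mathcomp Require Import all_boot all_order all_algebra.
From mathcomp Require Import all_classical all_reals all_analysis.
From mathcomp Require Import measurable_realfun complex ring lra.

(** Write [psi] for the digamma function.  Integrating [{t} / t^2] over each
    interval [[i, i+1[] and telescoping gives
    [ln N + int_N^oo {t}/t^2 dt = H_N - gamma = psi (N + 1)], so the sequence is
    [psi (k + 3) / k!].  Since [psi / Gamma] is minus the derivative of
    [1 / Gamma], this is the value at [k] of
    [- (z + 1) (z + 2) (1 / Gamma)' (z + 3)], an entire function in the
    Laguerre-Polya class all of whose zeros are real and negative; by a theorem
    of Laguerre the values of such a function at the natural numbers form a
    multiplier sequence.

    The proof replaces [1 / Gamma] by Gauss's polynomial approximations, so that
    only polynomials occur.  With [Q_n = (X + 3) (X + 4) ... (X + n + 2)], the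
    polynomial [ln (n + 1) Q_n - Q_n'] is, up to the factor
    [n! (n + 1) ^ (z + 2)], the approximation of [- (1 / Gamma)' (z + 3)].
    - Real-rootedness of [c Q - Q'] ([no_nonreal_zerosZB_deriv]) and of
      [(x D + a) p] for [0 <= a] ([multiplier_sequence_addn]) both come from one
      remark ([no_nonreal_zeros_logderiv]): at a non-real [z] the logarithmic
      derivative [\sum_r 1 / (z - r)] of a non-constant real-rooted polynomial
      has an imaginary part of sign strictly opposite to that of [z].
    - Factoring a real-rooted polynomial without positive root reduces
      Laguerre's theorem for polynomials ([Laguerre_multiplier_sequence]) to the
      operators [x D + a].
    - On [x > 0] the quotient [ln (n + 1) - \sum_j 1 / (x + j + 3)] of
      [ln (n + 1) Q_n - Q_n'] by [Q_n] is at least its value at [0], which tends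
      to [psi 3 > 0]; hence there are no positive roots for large [n]
      ([multiplier_sequence_Gauss_deriv_poly]).
    - Multiplier sequences are closed under termwise limits
      ([multiplier_sequence_cvg]), and [cvg_Gauss_factorial] and
      [cvg_digammaS] identify the limit. *)

Set Implicit Arguments.
Unset Strict Implicit.
Unset Printing Implicit Defensive.

Import Order.TTheory GRing.Theory Num.Theory.
Import numFieldNormedType.Exports.

Local Notation Re := complex.Re.
Local Notation Im := complex.Im.

Local Open Scope classical_set_scope.
Local Open Scope ring_scope.
Local Open Scope complex_scope.

(** * Polynomials with only real zeros *)

Lemma deriv_prod_XsubC (F : fieldType) (s : seq F) (x : F) :
    x \notin s ->
  (\prod_(r <- s) ('X - r%:P))^`().[x] =
    (\prod_(r <- s) ('X - r%:P)).[x] * \sum_(r <- s) (x - r)^-1.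
Proof.
elim: s => [|r s IHs]; first by rewrite !big_nil derivC horner0 mulr0.
rewrite inE negb_or => /andP[xr xs].
rewrite !big_cons derivM derivXsubC mul1r hornerD !hornerM hornerXsubC IHs //.
by field; rewrite subr_eq0.
Qed.

Section RealRooted.
Variable R : realType.
Implicit Types (p q : {poly R}) (z w : R[i]).

Local Notation toC := (real_complex R).

Lemma Im_inv_subC z (r : R) : Im z != 0 -> Im z * Im (z - r%:C)^-1 < 0.
Proof.
case: z => a b /= b0.
have b2 : 0 < b ^+ 2 by rewrite exprn_even_gt0.
have d : 0 < (a - r) ^+ 2 + b ^+ 2 by have := sqr_ge0 (a - r); lra.
by rewrite oppr0 addr0 mulrN oppr_lt0 mulrA -expr2 divr_gt0.
Qed.

Lemma no_nonreal_zeros_factor p : no_nonreal_zeros p ->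
  exists s : seq R, p = lead_coef p *: \prod_(r <- s) ('X - r%:P).
Proof.
case=> [->|hp]; first by exists [::]; rewrite lead_coef0 scale0r.
have [rs pE] := closed_field_poly_normal (map_poly toC p).
exists [seq Re z | z <- rs]; apply: (map_poly_inj toC).
have [->|p0] := eqVneq p 0; first by rewrite lead_coef0 scale0r.
rewrite map_polyZ rmorph_prod/= big_map {1}pE lead_coef_map; congr (_ *: _).
apply: eq_big_seq => z zrs; rewrite map_polyXsubC; congr ('X - _%:P).
have : Im z = 0.
  apply: hp; rewrite pE rootZ ?root_prod_XsubC//.
  by rewrite lead_coef_map fmorph_eq0 lead_coef_eq0.
by case: z {zrs} => a b /= ->.
Qed.

(** If [p] had a root then [w] would be [\sum_r 1 / (z - r)], and
    [Im z * Im (1 / (z - r)) = - (Im z / `|z - r|) ^+ 2] is negative for every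
    real [r].  So on either half-plane [p' / p] avoids every [w] that is real or
    has an imaginary part of the same sign as [z]. *)
Lemma no_nonreal_zeros_logderiv p z w :
    no_nonreal_zeros p -> p != 0 -> Im z != 0 -> 0 <= Im z * Im w ->
    (map_poly toC p)^`().[z] = w * (map_poly toC p).[z] ->
  (size p <= 1)%N.
Proof.
move=> hp p0 z0 zw; have [s pE] := no_nonreal_zeros_factor hp.
have l0 : toC (lead_coef p) != 0 by rewrite fmorph_eq0 lead_coef_eq0.
have PE : map_poly toC p =
    toC (lead_coef p) *: \prod_(r <- map toC s) ('X - r%:P).
  rewrite {1}pE map_polyZ rmorph_prod/= big_map; congr (_ *: _).
  by apply: eq_bigr => r _; rewrite map_polyXsubC.
have zs : z \notin map toC s.
  by apply/mapP => -[r _ zr]; rewrite zr/= eqxx in z0.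
have Pz : (\prod_(r <- map toC s) ('X - r%:P)).[z] != 0.
  by rewrite -[_ == 0]/(root _ z) root_prod_XsubC.
rewrite PE derivZ !hornerZ deriv_prod_XsubC// => /eqP.
rewrite [w * _]mulrCA (inj_eq (mulfI l0)) [w * _]mulrC.
rewrite (inj_eq (mulfI Pz)) => /eqP wE.
case: s => [|r s] in pE PE zs Pz wE *.
  by rewrite pE big_nil size_scale ?lead_coef_eq0// size_poly1.
suff : Im z * Im w < 0 by rewrite ltNge zw.
have ImD (x y : R[i]) : Im (x + y) = Im x + Im y by case: x y => [? ?] [].
rewrite -wE big_cons ImD mulrDr ltr_wnDr ?Im_inv_subC// big_map.
elim/big_rec: _ => [|t y _ IH]; first by rewrite mulr0.
by rewrite ImD mulrDr; move/(Im_inv_subC t): z0; lra.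
Qed.

Lemma no_nonreal_zeros_size1 p : (size p <= 1)%N -> no_nonreal_zeros p.
Proof.
move/size1_polyC ->; have [->|c0] := eqVneq p`_0 0; first by left.
by right=> z; rewrite map_polyC rootC fmorph_eq0 (negPf c0).
Qed.

Lemma no_nonreal_zeros_XsubC (r : R) : no_nonreal_zeros ('X - r%:P).
Proof. by right=> z; rewrite map_polyXsubC root_XsubC => /eqP ->. Qed.

Lemma no_nonreal_zerosM p q :
  no_nonreal_zeros p -> no_nonreal_zeros q -> no_nonreal_zeros (p * q).
Proof.
case=> [->|hp]; first by left; rewrite mul0r.
case=> [->|hq]; first by left; rewrite mulr0.
by right=> z; rewrite rmorphM rootM => /orP[/hp|/hq].
Qed.

Lemma no_nonreal_zerosZ (c : R) p :
  no_nonreal_zeros p -> no_nonreal_zeros (c *: p).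
Proof.
move=> hp; rewrite -mul_polyC; apply: no_nonreal_zerosM hp.
by apply: no_nonreal_zeros_size1; rewrite size_polyC leq_b1.
Qed.

Lemma no_nonreal_zeros_prod (s : seq R) :
  no_nonreal_zeros (\prod_(r <- s) ('X - r%:P)).
Proof.
elim/big_rec: _ => [|r p _ hp].
  by apply: no_nonreal_zeros_size1; rewrite size_poly1.
by apply: no_nonreal_zerosM hp; exact: no_nonreal_zeros_XsubC.
Qed.

(** At a non-real root [p' / p] would be the real number [c]. *)
Lemma no_nonreal_zerosZB_deriv (c : R) p :
  no_nonreal_zeros p -> no_nonreal_zeros (c *: p - p^`()).
Proof.
move=> hp; have [sp|sp] := leqP (size p) 1.
  rewrite (size1_polyC sp) derivC subr0 -(size1_polyC sp).
  exact: no_nonreal_zerosZ.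
right=> z; rewrite /root rmorphB/= map_polyZ -deriv_map hornerD hornerN hornerZ.
rewrite subr_eq0 eq_sym => /eqP pz.
apply/eqP; apply: contraLR (sp) => z0; rewrite -leqNgt.
apply: (@no_nonreal_zeros_logderiv p z (toC c)) => //; last by rewrite /= mulr0.
by rewrite -size_poly_gt0 ltnW.
Qed.

End RealRooted.

(** * Laguerre's theorem for polynomials *)

Section MultiplierSequences.
Variable R : realType.
Implicit Types (p : {poly R}) (z : R[i]) (g h : nat -> R).

Local Notation toC := (real_complex R).

Lemma eq_multiplier_sequence g h :
  g =1 h -> multiplier_sequence g -> multiplier_sequence h.
Proof. by move=> /funext ->. Qed.

(** The operator of a termwise product is the composition of the operators. *)
Lemma multiplier_sequenceM g h :
    multiplier_sequence g -> multiplier_sequence h ->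
  multiplier_sequence (fun k => g k * h k).
Proof.
move=> hg hh p /hh /hg; congr no_nonreal_zeros.
by apply/polyP => k; rewrite !coef_diag_op mulrA.
Qed.

Lemma multiplier_sequence_cst (c : R) : multiplier_sequence (fun=> c).
Proof.
move=> p hp; suff -> : diag_op (fun=> c) p = c *: p.
  exact: no_nonreal_zerosZ.
by apply/polyP => k; rewrite coef_diag_op coefZ.
Qed.

Lemma horner_map_diag_op g p z :
  (map_poly toC (diag_op g p)).[z] = \sum_(k < size p) toC (g k * p`_k) * z ^+ k.
Proof.
rewrite (@horner_coef_wide _ (size p)); last first.
  by rewrite size_map_poly size_poly.
by apply: eq_bigr => k _; rewrite coef_map coef_diag_op.
Qed.

(** The operator is the substitution of [c x] for [x]. *)
Lemma multiplier_sequence_geom (c : R) :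
  multiplier_sequence (fun k => c ^+ k).
Proof.
have [->|c0] := eqVneq c 0.
  move=> p _; apply: no_nonreal_zeros_size1; apply/leq_sizeP => -[//|k] _.
  by rewrite coef_diag_op expr0n mul0r.
move=> p [->|hp]; first by left; rewrite linear0.
right=> z; rewrite /root horner_map_diag_op => pz.
have : root (map_poly toC p) (toC c * z).
  rewrite /root (@horner_coef_wide _ (size p)) ?size_map_poly//.
  rewrite (eq_bigr (fun k : 'I_ _ => toC (c ^+ k * p`_k) * z ^+ k)) => [//|k _].
  by rewrite coef_map/= exprMn rmorphM rmorphXn/= mulrA [toC c ^+ _ * _]mulrC.
move/hp; case: z {pz} => a b /=.
by rewrite mul0r addr0 => /eqP; rewrite mulf_eq0 (negPf c0) => /eqP.
Qed.

(** The operator is [p |-> x p' + a p].  At a non-real root [z] of the image,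
    [p' / p] would be [- a / z], whose imaginary part is not of the sign opposite
    to that of [Im z]; hence [p] is constant, and so is its image, which has a
    root and is therefore zero. *)
Lemma multiplier_sequence_addn (a : R) :
  0 <= a -> multiplier_sequence (fun k => k%:R + a).
Proof.
move=> a0 p hp; set q := diag_op _ p.
have qE : q = 'X * p^`() + a *: p.
  apply/polyP => k; rewrite coef_diag_op coefD coefZ coefXM coef_deriv mulrDl.
  by case: k => [|k] /=; rewrite ?mulr0n ?mul0r ?mulr_natl.
have [->|q0] := eqVneq q 0; [by left | right=> z].
rewrite qE /root rmorphD rmorphM/= map_polyX map_polyZ -deriv_map.
rewrite hornerD hornerM hornerX hornerZ addr_eq0 => /eqP zq.
apply: contra_neq_eq q0 => z0.
have nz0 : z != 0 by apply: contra_neq z0 => ->.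
have [p0|p0] := eqVneq p 0; first by rewrite qE p0 deriv0 mulr0 scaler0 addr0.
have sp : (size p <= 1)%N.
  apply: (@no_nonreal_zeros_logderiv _ p z (- toC a / z)) => //.
    case: z z0 {zq nz0} => x y /= y0; rewrite !oppr0 mul0r addr0 mulrN mulNr opprK.
    by rewrite mulrCA mulr_ge0// mulrA -expr2 divr_ge0 ?addr_ge0 ?sqr_ge0.
  apply: (mulfI nz0); rewrite zq; field; exact: nz0.
have dp : p^`() = 0 by rewrite (size1_polyC sp) derivC.
move: zq; rewrite deriv_map dp rmorph0 horner0 mulr0 => /eqP.
rewrite qE dp mulr0 add0r eq_sym oppr_eq0 mulf_eq0 => /orP[|].
  by rewrite fmorph_eq0 => /eqP ->; rewrite scale0r.
rewrite (size1_polyC sp) map_polyC hornerC fmorph_eq0 => /eqP ->.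
by rewrite scaler0.
Qed.

(** If [p] is [c] times the product of the [X - r] then its operator is [c] times
    the composition of the operators [x D - r], where no [r] is positive. *)
Theorem Laguerre_multiplier_sequence p :
    no_nonreal_zeros p -> (forall x, 0 < x -> p.[x] != 0) ->
  multiplier_sequence (fun k => p.[k%:R]).
Proof.
move=> /no_nonreal_zeros_factor[s ->]; set c := lead_coef _ => s0.
have {s0} : {in s, forall r, r <= 0}.
  move=> r rs; rewrite leNgt; apply/negP => /s0 /negP; apply.
  by rewrite hornerZ mulf_eq0 -[_.[r] == 0]/(root _ _) root_prod_XsubC rs orbT.
move=> s0; apply: (@eq_multiplier_sequence
    (fun k => c * (\prod_(r <- s) ('X - r%:P)).[k%:R])).
  by move=> k; rewrite hornerZ.
apply: multiplier_sequenceM (multiplier_sequence_cst c) _.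
elim: s s0 => [_|r s IH s0].
  apply: (@eq_multiplier_sequence (fun=> 1)); last exact: multiplier_sequence_cst.
  by move=> k; rewrite big_nil hornerC.
apply: (@eq_multiplier_sequence
    (fun k => (k%:R - r) * (\prod_(r <- s) ('X - r%:P)).[k%:R])).
  by move=> k; rewrite big_cons hornerM hornerXsubC.
apply: multiplier_sequenceM.
  by apply: multiplier_sequence_addn; rewrite oppr_ge0 s0 ?mem_head.
by apply: IH => t ts; rewrite s0// inE ts orbT.
Qed.

(** The square of the complex modulus, with values in the real field itself so
    that it can be compared with squares of real values and passed to real
    limits. *)
Definition sqmod z : R := Re z ^+ 2 + Im z ^+ 2.

Lemma sqmodM z w : sqmod (z * w) = sqmod z * sqmod w.
Proof. by case: z w => a b [c d]; rewrite /sqmod /=; ring. Qed.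

Lemma sqmod_ge0 z : 0 <= sqmod z.
Proof. by rewrite addr_ge0 ?sqr_ge0. Qed.

(** A real-rooted polynomial cannot be small at a non-real point without being
    small everywhere on the real line: root by root, [|x - r|] is at most a
    constant times [|z - r|], because [z] stays at distance [|Im z|] from every
    [r].  The constant depends on [x] and [z] only, which makes the bound stable
    under limits of polynomials of bounded degree. *)
Lemma no_nonreal_zeros_growth z (x : R) : Im z != 0 -> exists2 K : R, 1 <= K &
  forall p, no_nonreal_zeros p ->
    p.[x] ^+ 2 <= K ^+ (size p).-1 * sqmod (map_poly toC p).[z].
Proof.
case: z => a b /= b0.
have b2 : 0 < b ^+ 2 by rewrite exprn_even_gt0.
have t0 : 0 <= 2 * (x - a) ^+ 2 / b ^+ 2.
  by rewrite divr_ge0 ?sqr_ge0// mulr_ge0 ?sqr_ge0 ?ler0n.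
set K := 2 + 2 * (x - a) ^+ 2 / b ^+ 2; exists K; first by rewrite /K; lra.
have K0 : 0 <= K by rewrite /K; lra.
move=> p /no_nonreal_zeros_factor[s pE].
have [->|p0] := eqVneq p 0.
  by rewrite horner0 rmorph0 horner0 expr0n/= mulr_ge0 ?exprn_ge0 ?sqmod_ge0.
have -> : (size p).-1 = size s.
  by rewrite pE size_scale ?lead_coef_eq0// size_prod_XsubC.
rewrite {1 2}pE; set c := lead_coef p.
rewrite map_polyZ !hornerZ sqmodM exprMn [leRHS]mulrCA.
have -> : sqmod (toC c) = c ^+ 2 by rewrite /sqmod /= expr0n addr0.
rewrite ler_wpM2l ?sqr_ge0// => {pE p0 c p}.
elim: s => [|r s IH] /=.
  by rewrite !big_nil rmorph1 !hornerC /sqmod/= expr0n/= addr0 expr0 mul1r.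
rewrite !big_cons rmorphM/= map_polyXsubC !hornerM !hornerXsubC sqmodM.
rewrite exprMn [K ^+ _]exprS [leRHS]mulrACA ler_pM ?sqr_ge0//.
(* With [u = x - a] and [v = a - r] the claim is
   [(u + v)^2 <= (2 + 2 u^2 / b^2) (v^2 + b^2)], a consequence of
   [(u + v)^2 <= 2 u^2 + 2 v^2]. *)
rewrite /sqmod /= oppr0 addr0 /K.
have -> : (2 + 2 * (x - a) ^+ 2 / b ^+ 2) * ((a - r) ^+ 2 + b ^+ 2) =
   2 * (x - a) ^+ 2 + 2 * (a - r) ^+ 2 + 2 * b ^+ 2
   + 2 * ((x - a) * (a - r) / b) ^+ 2 by field.
have := sqr_ge0 ((x - a) * (a - r) / b).
have := sqr_ge0 ((x - a) - (a - r)).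
have -> : (x - r) ^+ 2 = ((x - a) + (a - r)) ^+ 2 by congr (_ ^+ 2); ring.
by move: ((x - a) * (a - r) / b) => t; move: (x - a) (a - r) => u v; nra.
Qed.

End MultiplierSequences.

(** * Termwise limits of multiplier sequences *)

Section Limits.
Variable R : realType.
Implicit Types (p : {poly R}) (z : R[i]) (g h : nat -> R).

Local Notation toC := (real_complex R).

Lemma poly_horner_eq0 p : (forall x, p.[x] = 0) -> p = 0.
Proof.
move=> p0; apply: (@roots_geq_poly_eq0 _ p [seq i%:R | i <- iota 0 (size p)]).
- by apply/allP => x _; apply/eqP.
- by rewrite map_inj_uniq ?iota_uniq//; exact: mulrIn.
- by rewrite size_map size_iota.
Qed.

Lemma cvg_sum_ord (m : nat) (u : nat -> 'I_m -> R) (l : 'I_m -> R) :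
    (forall i, u n i @[n --> \oo] --> l i) ->
  \sum_(i < m) u n i @[n --> \oo] --> \sum_(i < m) l i.
Proof. by move=> ul; apply: cvg_big => //; exact: add_continuous. Qed.

(** An elementary substitute for Hurwitz's theorem, which also covers a drop of
    the degree in the limit: if the limit [q] of the real-rooted images [q_ n]
    vanishes at a non-real [z], then the uniform bound [no_nonreal_zeros_growth]
    on [q_ n] passes to the limit and makes [q] vanish on the whole real
    line. *)
Theorem multiplier_sequence_cvg (g_ : nat -> nat -> R) g :
    (\forall n \near \oo, multiplier_sequence (g_ n)) ->
    (forall k, g_ n k @[n --> \oo] --> g k) ->
  multiplier_sequence g.
Proof.
move=> mg cg p hp; set q := diag_op g p.
have [->|q0] := eqVneq q 0; [by left | right=> z qz].
apply: contra_neq_eq q0 => z0; apply: poly_horner_eq0 => x.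
have [K K1 growth] := no_nonreal_zeros_growth x z0.
pose q_ n := diag_op (g_ n) p.
(* [L] stands for [Re] and for [Im]. *)
have cvg_coord (L : R[i] -> R) : L 0 = 0 -> {morph L : v w / v + w} ->
    (forall a w, L (toC a * w) = a * L w) ->
    L (map_poly toC (q_ n)).[z] @[n --> \oo] --> L (map_poly toC q).[z].
  move=> L0 LD LZ.
  have LE h : L (map_poly toC (diag_op h p)).[z] =
      \sum_(k < size p) h k * (p`_k * L (z ^+ k)).
    rewrite horner_map_diag_op (big_morph L LD L0).
    by apply: eq_bigr => k _; rewrite LZ mulrA.
  rewrite LE; under eq_fun do rewrite LE.
  by apply: cvg_sum_ord => k; apply: cvgM (cg k) _; exact: cvg_cst.
have cvg_sqmod : sqmod (map_poly toC (q_ n)).[z] @[n --> \oo] --> (0 : R).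
  rewrite (_ : 0 = sqmod (map_poly toC q).[z]); last first.
    by rewrite (eqP qz) /sqmod /= expr0n addr0.
  rewrite /sqmod !expr2; under eq_fun do rewrite !expr2.
  apply: cvgD; apply: cvgM; apply: cvg_coord => //.
  - by case=> ? ? [].
  - by move=> a [? ?] /=; rewrite mul0r subr0.
  - by case=> ? ? [].
  - by move=> a [? ?] /=; rewrite mul0r subr0.
  - by case=> ? ? [].
  - by move=> a [? ?] /=; rewrite mul0r addr0.
  - by case=> ? ? [].
  - by move=> a [? ?] /=; rewrite mul0r addr0.
have cvg_x : (q_ n).[x] @[n --> \oo] --> q.[x].
  have qE h : (diag_op h p).[x] = \sum_(k < size p) h k * (p`_k * x ^+ k).
    rewrite (@horner_coef_wide _ (size p)) ?size_poly//.
    by apply: eq_bigr => k _; rewrite coef_diag_op mulrA.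
  rewrite qE; under eq_fun do rewrite qE.
  by apply: cvg_sum_ord => k; apply: cvgM (cg k) _; exact: cvg_cst.
apply/eqP; rewrite -sqrf_eq0 eq_le sqr_ge0 andbT.
rewrite -(mulr0 (K ^+ size p)) expr2.
apply: ler_cvg_to (cvgM cvg_x cvg_x) (cvgM (cvg_cst _) cvg_sqmod) _.
apply: filterS mg => n /(_ p hp) /growth; rewrite /= expr2 => /le_trans; apply.
rewrite ler_wpM2r ?sqmod_ge0// ler_weXn2l//.
by rewrite (leq_trans (leq_pred _))// size_poly.
Qed.

End Limits.

(** * The integral of the fractional part *)

Section FractionalPartIntegral.
Variable R : realType.

Local Notation mu := (@lebesgue_measure R).
Local Notation unit_itv i := (`[i%:R : R, i.+1%:R[).

Lemma floor_unit_itv (i : nat) (t : R) : t \in unit_itv i -> Num.floor t = i.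
Proof.
rewrite in_itv/= => /andP[it ti]; apply: floor_def.
by rewrite it (_ : Posz i + 1 = Posz i.+1)// -addn1 PoszD.
Qed.

Lemma itvcy_bigcup_unit_itv (N : nat) :
  `[N%:R : R, +oo[%classic = \bigcup_j [set` unit_itv (N + j)].
Proof.
apply/seteqP; split=> [t|t [j _]] /=; rewrite !in_itv/= ?andbT.
  move=> Nt; have t0 : 0 <= t by rewrite (le_trans _ Nt).
  have /andP[lt tl] := truncn_itv t0.
  have Nl : (N <= Num.truncn t)%N by rewrite -ltnS -(ltr_nat R) (le_lt_trans Nt).
  by exists (Num.truncn t - N)%N => //=; rewrite subnKC// in_itv/= lt tl.
by move=> /andP[+ _]; apply: le_trans; rewrite ler_nat leq_addr.
Qed.

Lemma trivIset_unit_itv (N : nat) :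
  trivIset setT (fun j => [set` unit_itv (N + j)]).
Proof.
move=> i j _ _ [t /= [/floor_unit_itv ti /floor_unit_itv]].
by rewrite ti => -[/addnI].
Qed.

Lemma frac_part_ge0 (t : R) : 0 <= frac_part t.
Proof. by rewrite subr_ge0 floor_le. Qed.

Lemma frac_part_unit_itv (i : nat) (t : R) : t \in unit_itv i ->
  frac_part t / t ^+ 2 = t^-1 - i%:R / t ^+ 2.
Proof.
move=> ti; rewrite /frac_part (floor_unit_itv ti) mulrBl.
have [->|t0] := eqVneq t 0; first by rewrite mul0r invr0.
by rewrite expr2 invfM mulrA divff// mul1r.
Qed.

Section UnitInterval.
Variable i : nat.
Hypothesis i0 : (0 < i)%N.

Let itv_gt0 (t : R) : i%:R <= t -> 0 < t.
Proof. by apply: lt_le_trans; rewrite ltr0n. Qed.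

Let f (t : R) := t^-1 - i%:R / t ^+ 2.
Let F (t : R) := ln t + i%:R / t.

Let is_derive_F (t : R) : i%:R <= t -> is_derive t 1 F (f t).
Proof.
move=> /itv_gt0 t0.
have tn0 : t != 0 by rewrite gt_eqF.
have dln := is_derive1_ln t0.
have dF := is_deriveD dln (is_deriveZ i%:R (is_deriveV tn0 (is_derive_id t 1))).
apply: is_derive_eq dF _.
by rewrite -[i%:R *: _]/(i%:R * (- t ^- 2 * 1)) mulr1 mulrN.
Qed.

Let f_continuous : {within `[i%:R, i.+1%:R], continuous f}.
Proof.
apply: continuous_in_subspaceT => t; rewrite inE/= in_itv/= => /andP[/itv_gt0 t0 _].
have tn0 : t != 0 by rewrite gt_eqF.
apply: cvgB; first exact: cvgV.
apply: cvgM; first exact: cvg_cst.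
by apply: cvgV; [rewrite expf_eq0 | exact: exprn_continuous].
Qed.

Let f_measurable : measurable_fun [set` unit_itv i] f.
Proof.
have mf : measurable_fun [set` `[i%:R : R, i.+1%:R]] f.
  exact: subspace_continuous_measurable_fun.
apply: measurable_funS mf => //.
by apply: subset_itvl; rewrite bnd_simp.
Qed.

Lemma measurable_frac_part_unit_itv :
  measurable_fun [set` unit_itv i] (fun t : R => frac_part t / t ^+ 2).
Proof.
apply: eq_measurable_fun f_measurable => t; rewrite inE/= => ti.
by rewrite (frac_part_unit_itv ti).
Qed.

Lemma integral_frac_part_unit_itv :
  (\int[mu]_(t in [set` unit_itv i]) (frac_part t / t ^+ 2)%:E =
   (ln i.+1%:R - ln i%:R - i.+1%:R^-1)%:E)%E.
Proof.
transitivity (\int[mu]_(t in [set` unit_itv i]) (f t)%:E)%E.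
  by apply: eq_integral => t; rewrite inE/= => ti; rewrite (frac_part_unit_itv ti).
rewrite integral_itv_bndo_bndc; last exact/measurable_EFinP.
rewrite (@continuous_FTC2 _ f F)//; last 3 first.
- by rewrite ltr_nat.
- have Fc : {within `[i%:R, i.+1%:R], continuous F}.
    apply: derivable_within_continuous => t; rewrite in_itv/= => /andP[it _].
    exact: (@ex_derive _ _ _ _ _ _ _ (is_derive_F it)).
  have ii : i%:R < i.+1%:R :> R by rewrite ltr_nat.
  move: Fc => /(continuous_within_itvP _ ii)[_ Fl Fr].
  split => // t; rewrite in_itv/= => /andP[/ltW it _].
  exact: (@ex_derive _ _ _ _ _ _ _ (is_derive_F it)).
- move=> t; rewrite in_itv/= => /andP[/ltW it _].
  by rewrite derive1E (@derive_val _ _ _ _ _ _ _ (is_derive_F it)).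
rewrite -EFinB /F divff ?pnatr_eq0 -?lt0n//; congr (_%:E).
by rewrite -[i.+1]addn1 natrD; field; rewrite natr1 pnatr_eq0.
Qed.

End UnitInterval.

(** The integral telescopes: its part over [[i, i + 1[] is
    [ln (i + 1) - ln i - 1 / (i + 1)].  The partial sums of these nonnegative
    numbers are bounded, since [ln (1 + 1 / i) <= 1 / i] puts each number
    below the telescoping [1 / i - 1 / (i + 1)]; so the integral is finite and
    is their limit. *)
Lemma cvg_integral_frac_part (N : nat) : (0 < N)%N ->
  ln (N + n)%:R - \sum_(j < n) (N + j).+1%:R^-1 @[n --> \oo] -->
  ln N%:R + \int[mu]_(t in `[N%:R, +oo[) (frac_part t / t ^+ 2).
Proof.
move=> N0; pose u i : R := ln i.+1%:R - ln i%:R - i.+1%:R^-1.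
pose S n := \sum_(0 <= j < n) u (N + j)%N.
have SE n : S n = ln (N + n)%:R - \sum_(j < n) (N + j).+1%:R^-1 - ln N%:R.
  elim: n => [|n IH]; first by rewrite /S big_geq// big_ord0 addn0 subr0 subrr.
  rewrite /S big_nat_recr//= -/(S n) IH big_ord_recr/= /u addnS.
  by move: (ln _) (ln _) (\sum_(_ < _) _) (ln _) (_^-1) => *; ring.
have f0 (t : R) : 0 <= frac_part t / t ^+ 2.
  by rewrite divr_ge0 ?sqr_ge0 ?frac_part_ge0.
have NS j : (0 < N + j)%N by rewrite addn_gt0 N0.
have u0 j : 0 <= u (N + j)%N.
  rewrite -lee_fin -integral_frac_part_unit_itv//.
  by apply: integral_ge0 => t _; rewrite lee_fin.
have S_nd : nondecreasing_seq S.
  by apply/nondecreasing_seqP => n; rewrite /S big_nat_recr//= lerDl.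
have S_ub : has_ubound (range S).
  exists N%:R^-1 => _ [n _ <-].
  suff : S n <= N%:R^-1 - (N + n)%:R^-1.
    by move/le_trans; apply; rewrite lerBlDr lerDl invr_ge0.
  elim: n => [|n IH]; first by rewrite /S big_geq// addn0 subrr.
  rewrite /S big_nat_recr//= -/(S n) addnS.
  suff : u (N + n)%N <= (N + n)%:R^-1 - (N + n).+1%:R^-1
    by move/(lerD IH); rewrite [leRHS]addrA subrK.
  rewrite /u lerD2r -ln_div ?posrE ?ltr0n//.
  have -> : (N + n).+1%:R / (N + n)%:R = 1 + (N + n)%:R^-1 :> R.
    by rewrite -natr1 mulrDl mul1r divff// pnatr_eq0 -lt0n.
  by apply: le_ln1Dx; rewrite (@lt_le_trans _ _ 0)// ?ltrN10// invr_ge0.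
have S_cvg := nondecreasing_is_cvgn S_nd S_ub.
have -> : \int[mu]_(t in `[N%:R, +oo[) (frac_part t / t ^+ 2) = limn S.
  rewrite /Rintegral; transitivity (fine (limn S)%:E) => //; congr fine.
  rewrite itvcy_bigcup_unit_itv ge0_integral_bigcup//=.
  - rewrite -(@EFin_lim _ S)//; congr (lim (_ @ \oo)).
    apply/funext => n /=; rewrite /S -sumEFin.
    by apply: eq_bigr => j _; rewrite integral_frac_part_unit_itv.
  - apply/measurable_EFinP/measurable_fun_bigcup => // j.
    exact: measurable_frac_part_unit_itv.
  - by move=> t _; rewrite lee_fin.
  - exact: trivIset_unit_itv.
rewrite (_ : (fun n => _) = (fun n => ln N%:R + S n)).
  by apply: cvgD => //; exact: cvg_cst.
by apply/funext => n; rewrite SE [RHS]addrC subrK.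
Qed.

End FractionalPartIntegral.

(** * Gauss's approximation of the digamma sequence *)

Section DigammaSequence.
Variable R : realType.
Implicit Types (N k n : nat) (x : R).

Local Notation mu := (@lebesgue_measure R).

Lemma cvg_shift_ratio N : (N + n)%:R / n.+1%:R @[n --> \oo] --> (1 : R).
Proof.
rewrite (_ : (fun n => _) = (fun n => 1 + (N%:R - 1) * harmonic n)).
  rewrite -[X in _ --> X]addr0 -(mulr0 (N%:R - 1)).
  by apply: cvgD; [exact: cvg_cst | apply: cvgM cvg_harmonic; exact: cvg_cst].
apply/funext => n; rewrite /harmonic /= natrD -(natr1 n); field.
by rewrite natr1 pnatr_eq0.
Qed.

(** Equal to [H_N - gamma = psi (N + 1)], where [H_N] is a harmonic number and
    [gamma] is Euler's constant. *)
Definition digammaS N : R :=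
  ln N%:R + \int[mu]_(t in `[N%:R, +oo[) (frac_part t / t ^+ 2).

Lemma digammaS_gt0 N : (1 < N)%N -> 0 < digammaS N.
Proof.
move=> N1; rewrite ltr_pwDl// ?ln_gt0 ?ltr1n//.
by apply: Rintegral_ge0 => t _; rewrite divr_ge0 ?sqr_ge0 ?frac_part_ge0.
Qed.

(** [ln (N + n)] may be replaced by [ln (n + 1)] in [cvg_integral_frac_part]
    because [(N + n) / (n + 1)] tends to [1]; the new first term does not depend
    on [N], so that a single polynomial can serve all the terms. *)
Lemma cvg_digammaS N : (0 < N)%N ->
  ln n.+1%:R - \sum_(j < n) (N + j).+1%:R^-1 @[n --> \oo] --> digammaS N.
Proof.
move=> N0.
rewrite (_ : (fun n => _) = (fun n => ln (N + n)%:R -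
    \sum_(j < n) (N + j).+1%:R^-1 - ln ((N + n)%:R / n.+1%:R))).
  rewrite (_ : digammaS N = digammaS N - ln 1); last by rewrite ln1 subr0.
  apply: cvgB.
    exact: cvg_integral_frac_part.
  by apply: continuous_cvg (cvg_shift_ratio N); exact: continuous_ln.
apply/funext => n; rewrite ln_div ?posrE ?ltr0n ?addn_gt0 ?N0//.
by ring.
Qed.

(** Gauss's product for [1 / Gamma (N + 1)].  The product on the left is
    [(N + n)! / N!]; raising [N] by one multiplies the whole expression by
    [(N + 1 + n) / (n + 1)], which tends to [1], and by [1 / (N + 1)]. *)
Lemma cvg_Gauss_factorial N :
  \prod_(j < n) (N + j).+1%:R / (n`!%:R * n.+1%:R ^+ N) @[n --> \oo] -->
  (N`!%:R^-1 : R).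
Proof.
have prodE n : \prod_(j < n) (N + j).+1%:R = (N + n)`!%:R / N`!%:R :> R.
  have fN : N`!%:R != 0 :> R by rewrite pnatr_eq0 -lt0n fact_gt0.
  elim: n => [|n IH]; first by rewrite big_ord0 addn0 divff.
  by rewrite big_ord_recr/= IH addnS factS natrM mulrAC [_ * (N + n)`!%:R]mulrC.
under eq_fun do rewrite prodE.
elim: N {prodE} => [|N IH].
  rewrite (_ : (fun n => _) = cst 1); first by rewrite fact0 invr1; exact: cvg_cst.
  apply/funext => n; rewrite add0n expr0 mulr1 fact0 divr1.
  by rewrite divff// pnatr_eq0 -lt0n fact_gt0.
rewrite (_ : (fun n => _) = (fun n => (N + n)`!%:R / N`!%:R /
    (n`!%:R * n.+1%:R ^+ N) * ((N.+1 + n)%:R / n.+1%:R) * N.+1%:R^-1)).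
  rewrite factS natrM invfM mulrC -[X in X / N.+1%:R]mulr1.
  apply: cvgM (cvg_cst _); exact: cvgM IH (cvg_shift_ratio _).
apply/funext => n; rewrite addSn !factS !natrM exprS.
have f0 m : m`!%:R != 0 :> R by rewrite pnatr_eq0 -lt0n fact_gt0.
have s0 m : m.+1%:R != 0 :> R by rewrite pnatr_eq0.
have en : n.+1%:R ^+ N != 0 :> R by rewrite expf_neq0.
by field; rewrite !f0 en ![1 + _]addrC !natr1 !s0.
Qed.

Definition Gauss_poly n : {poly R} :=
  \prod_(r <- [seq - j.+3%:R | j <- index_iota 0 n]) ('X - r%:P).

(** Up to the normalization [n! (n + 1) ^ (z + 2)], [Gauss_poly n] at [z]
    approximates [1 / Gamma (z + 3)], and the last factor below approximates
    minus the derivative of that function.  The two linear factors turn the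
    denominator [(k + 2)!] into [k!]. *)
Definition Gauss_deriv_poly n : {poly R} :=
  ('X - (- 1)%:P) * ('X - (- 2)%:P) *
  (ln n.+1%:R *: Gauss_poly n - (Gauss_poly n)^`()).

Lemma no_nonreal_zeros_Gauss_deriv_poly n :
  no_nonreal_zeros (Gauss_deriv_poly n).
Proof.
apply: no_nonreal_zerosM.
  by apply: no_nonreal_zerosM; exact: no_nonreal_zeros_XsubC.
by apply: no_nonreal_zerosZB_deriv; exact: no_nonreal_zeros_prod.
Qed.

Lemma horner_Gauss_deriv_poly n x : 0 <= x ->
  (Gauss_deriv_poly n).[x] = (x + 1) * (x + 2) * \prod_(j < n) (x + j.+3%:R) *
    (ln n.+1%:R - \sum_(j < n) (x + j.+3%:R)^-1).
Proof.
move=> x0; rewrite /Gauss_deriv_poly !hornerM !hornerXsubC !opprK.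
rewrite hornerD hornerN hornerZ /Gauss_poly deriv_prod_XsubC; last first.
  apply/mapP => -[j _ xj]; have : 0 < x + j.+3%:R by rewrite ltr_wpDl// ltr0n.
  by rewrite xj addNr ltxx.
rewrite [_ * (\prod_(_ <- _) _).[x]]mulrC -mulrBr mulrA !big_map horner_prod.
rewrite !big_mkord; congr (_ * _ * (_ - _)).
  by apply: eq_bigr => j _; rewrite hornerXsubC opprK.
by apply: eq_bigr => j _; rewrite opprK.
Qed.

(** For [x > 0] the sign of the value is that of
    [ln (n + 1) - \sum_j 1 / (x + j + 3)], which increases with [x] and whose
    value at [0] tends to the positive number [digammaS 2]. *)
Lemma multiplier_sequence_Gauss_deriv_poly :
  \forall n \near \oo, multiplier_sequence (fun k => (Gauss_deriv_poly n).[k%:R]).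
Proof.
have d_gt0 : \forall n \near \oo,
    0 < ln n.+1%:R - \sum_(j < n) j.+3%:R^-1 :> R.
  exact: cvgr_gt (@cvg_digammaS 2 isT) _ (@digammaS_gt0 2 isT).
apply: filterS d_gt0 => n /= dn; apply: Laguerre_multiplier_sequence.
  exact: no_nonreal_zeros_Gauss_deriv_poly.
move=> x x0; rewrite horner_Gauss_deriv_poly ?ltW//.
have xj j : 0 < x + j.+3%:R by rewrite addr_gt0.
rewrite gt_eqF//; apply: mulr_gt0.
  by apply: mulr_gt0; [rewrite mulr_gt0 ?addr_gt0 | apply: prodr_gt0].
apply: lt_le_trans dn _; rewrite lerB// ler_sum// => j _.
by rewrite lef_pV2 ?posrE ?ltr0n// lerDr ltW.
Qed.

Theorem multiplier_sequence_digammaS :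
  multiplier_sequence (fun k => digammaS (k + 2) / k`!%:R).
Proof.
(* The powers of [n + 1] that depend on [k] form a geometric sequence. *)
pose g_ n k := (n`!%:R * n.+1%:R ^+ 2)^-1 *
  (n.+1%:R^-1 ^+ k * (Gauss_deriv_poly n).[k%:R]).
apply: (@multiplier_sequence_cvg _ g_) => [|k].
  apply: filterS multiplier_sequence_Gauss_deriv_poly => n mn.
  apply: multiplier_sequenceM; first exact: multiplier_sequence_cst.
  by apply: multiplier_sequenceM mn; exact: multiplier_sequence_geom.
rewrite (_ : g_^~ k = (fun n => (k%:R + 1) * (k%:R + 2) *
    (\prod_(j < n) (k + 2 + j).+1%:R / (n`!%:R * n.+1%:R ^+ (k + 2)) *
    (ln n.+1%:R - \sum_(j < n) (k + 2 + j).+1%:R^-1)))); last first.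
  have kj j : k%:R + j.+3%:R = (k + 2 + j).+1%:R :> R.
    by rewrite -natrD -addnA add2n !addnS.
  apply/funext => n; rewrite /g_ horner_Gauss_deriv_poly//.
  under eq_bigr do rewrite kj.
  under [X in _ - X]eq_bigr do rewrite kj.
  rewrite exprD exprVn.
  have fn : n`!%:R != 0 :> R by rewrite pnatr_eq0 -lt0n fact_gt0.
  have en : n.+1%:R ^+ k != 0 :> R by rewrite expf_neq0 ?pnatr_eq0.
  have sn : n.+1%:R != 0 :> R by rewrite pnatr_eq0.
  move: (\prod_(_ < _) _) (ln _ - _) => P L.
  move: n.+1%:R n`!%:R (n.+1%:R ^+ k) sn fn en => a b c a0 b0 c0.
  by field; rewrite a0 b0 c0.
have -> : digammaS (k + 2) / k`!%:R =
    (k%:R + 1) * (k%:R + 2) * ((k + 2)`!%:R^-1 * digammaS (k + 2)).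
  rewrite addn2 !factS !natrM -[k.+2]addn2 -[k.+1]addn1 !natrD.
  have fk : k`!%:R != 0 :> R by rewrite pnatr_eq0 -lt0n fact_gt0.
  by field; rewrite fk natr1 -natrD !pnatr_eq0 addn2.
apply: cvgM; first exact: cvg_cst.
by apply: cvgM; [exact: cvg_Gauss_factorial|apply: cvg_digammaS; rewrite addn2].
Qed.

End DigammaSequence.

(* The integrand is nonnegative on the domain, so the Lebesgue integral is the
   improper integral. *)
Theorem corollary13 (R : realType) :
  multiplier_sequence (fun k : nat =>
    (ln (k + 2)%:R
     + \int[@lebesgue_measure R]_(t in `[(k + 2)%:R, +oo[%classic)
         (frac_part t / t ^+ 2))
    / (k`!)%:R : R).
Proof. exact: multiplier_sequence_digammaS. Qed.
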